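(* Let $G$ be an embedded graph and $A\subseteq E(G)$. If the partial dual $G^{A}$ is checkerboard colourable, then $G-A$ and $G^{*}-A^{c}$ are both checkerboard colourable (and hence both Eulerian).
   Context: Embedded graphs are viewed as ribbon graphs (vertex discs and edge discs, each edge disc meeting vertices in two segments); faces are boundary components. $G^*$ is the geometric dual, with $E(G^* )$ identified with $E(G)$, and $A^c=E(G)\setminus A$. A ribbon graph is checkerboard colourable if its faces can be coloured red/blue so that for every edge the faces on its two sides (containing its two edge line segments, i.e. the arcs of $\partial e$ not meeting vertices) get different colours; Eulerian means all vertex degrees are even. The partial dual $G^A$ is defined via arrow presentations: represent $G$ by the boundary circles of its vertex discs carrying, for each edge $e$, two arrows labelled $e$ at the segments where $e$ meets vertices, directed consistently with an orientation of $\partial e$; for each $e\in A$ with arrows $\alpha,\beta$, add an arrowed segment from head of $\alpha$ to tail of $\beta$ and one from head of $\beta$ to tail of $\alpha$, label both $e$, and delete $\alpha,\beta$ and their underlying arcs; the result presents $G^A$. $G-A$ denotes deletion of the edges in $A$. *)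

(* Defs.v *)
From mathcomp Require Import all_boot.

Set Implicit Arguments.
Unset Strict Implicit.
Unset Printing Implicit Defensive.

(* A ribbon graph with edge set E is given by an arrow presentation.  The two *)
(* arrows labelled e are (e, false) and (e, true).  An endpoint of an arrow   *)
(* is a corner of the edge disc e, i.e. a point where e starts or stops       *)
(* meeting the boundary of a vertex disc.                                     *)
Notation arrow E := (E * bool)%type.
Notation endpoint E := ((E * bool) * bool)%type.

Section Endpoints.
Variable E : finType.
Implicit Types (a : arrow E) (x : endpoint E).

Definition arrow_tail a : endpoint E := (a, false).
Definition arrow_head a : endpoint E := (a, true).
Definition label x : E := x.1.1.

Definition mate a : arrow E := (a.1, ~~ a.2).

Definition along x : endpoint E := (x.1, ~~ x.2).

(* As the two arrows of e follow an orientation of the boundary of the disc   *)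
(* e, the two edge line segments of e join arrow_head a to arrow_tail (mate   *)
(* a), for each of the two arrows a of e.                                     *)
Definition line x : endpoint E := (mate x.1, ~~ x.2).

(* For each arrow a, draw an arrow along an edge line segment, from           *)
(* arrow_head a to arrow_tail (mate a), and name it a again: turn sends an    *)
(* endpoint of this new arrow to the corner where it lies.                    *)
Definition turn x : endpoint E :=
  if x.2 then arrow_tail (mate x.1) else arrow_head x.1.
Definition unturn x : endpoint E :=
  if x.2 then arrow_tail x.1 else arrow_head (mate x.1).

Lemma alongK : involutive along.
Proof. by case=> a b; rewrite /along /= negbK. Qed.

Lemma turnK : cancel turn unturn.
Proof. by case=> [[e i] []]; rewrite /unturn /turn /mate /= ?negbK. Qed.

Lemma unturnK : cancel unturn turn.
Proof. by case=> [[e i] []]; rewrite /unturn /turn /mate /= ?negbK. Qed.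

Lemma label_turn x : label (turn x) = label x.
Proof. by case: x => [[e i] []]. Qed.

Lemma label_unturn x : label (unturn x) = label x.
Proof. by case: x => [[e i] []]. Qed.

End Endpoints.

(* The boundary circles of the vertex discs that meet some edge are cut by    *)
(* the arrows into arcs; vertex_arc sends an endpoint of such an arc to the   *)
(* other one. Vertices that meet no edge carry no arrow and are only counted. *)
Record ribbon_graph (E : finType) := RibbonGraph {
  vertex_arc : endpoint E -> endpoint E;
  arcK : involutive vertex_arc;
  arc_neq : forall x, vertex_arc x != x;
  isolated : nat
}.

Section Circles.
Variable T : finType.
Implicit Types (f g : T -> T) (x : T).

(* For fixpoint-free involutions f and g, the closed curves made of segments  *)
(* x -- f x and x -- g x in alternation, each seen as the set of its points.  *)
Definition circle f g x : {set T} :=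
  [set y | connect [rel u v | (v == f u) || (v == g u)] x y].
Definition circles f g : {set {set T}} := [set circle f g x | x in T].

Lemma circle_in f g x : circle f g x \in circles f g.
Proof. exact: imset_f. Qed.

End Circles.

Section RibbonGraph.
Variables (E : finType) (G : ribbon_graph E).

Definition vertex : finType :=
  ({B : {set endpoint E} | B \in circles (vertex_arc G) (@along E)}
     + 'I_(isolated G))%type.

Definition degree (v : vertex) : nat :=
  match v with
  | inl B => #|[set a : arrow E | arrow_head a \in val B]|
  | inr _ => 0
  end.

Definition eulerian : Prop := forall v : vertex, ~~ odd (degree v).

(* Boundary components; that of an isolated vertex disc is its own circle.    *)
Definition face : finType :=
  ({B : {set endpoint E} | B \in circles (vertex_arc G) (@line E)}
     + 'I_(isolated G))%type.

Definition face_of (x : endpoint E) : face :=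
  inl (exist _ (circle (vertex_arc G) (@line E) x) (circle_in _ _ x)).

(* The two edge line segments of e start at the heads of its two arrows.      *)
Definition checkerboard : Prop :=
  exists c : face -> bool, forall e : E,
    c (face_of (arrow_head (e, false))) != c (face_of (arrow_head (e, true))).

End RibbonGraph.

Section Duals.
Variables (E : finType) (G : ribbon_graph E).

Definition dual_arc (x : endpoint E) : endpoint E :=
  unturn (vertex_arc G (turn x)).

Lemma dual_arcK : involutive dual_arc.
Proof. by move=> x; rewrite /dual_arc unturnK arcK turnK. Qed.

Lemma dual_arc_neq x : dual_arc x != x.
Proof.
apply: contraNneq (arc_neq G (turn x)) => {2}<-.
by rewrite /dual_arc unturnK.
Qed.

(* The vertex discs of the dual are glued along the faces of G, and each edge *)
(* disc now meets them in its former edge line segments.                      *)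
Definition geom_dual : ribbon_graph E :=
  RibbonGraph dual_arcK dual_arc_neq (isolated G).

Variable A : {set E}.

(* In the partial dual only the arrows with label in A are replaced: pturn    *)
(* sends an endpoint of an arrow of the partial dual to the place where it    *)
(* lies in the presentation of G, whose arcs are kept.                        *)
Definition pturn (x : endpoint E) : endpoint E :=
  if label x \in A then turn x else x.
Definition punturn (x : endpoint E) : endpoint E :=
  if label x \in A then unturn x else x.

Lemma pturnK : cancel pturn punturn.
Proof.
move=> x; rewrite /pturn; case: ifPn => [xA | /negbTE xA]; last first.
  by rewrite /punturn xA.
by rewrite /punturn label_turn xA turnK.
Qed.

Lemma punturnK : cancel punturn pturn.
Proof.
move=> x; rewrite /punturn; case: ifPn => [xA | /negbTE xA]; last first.
  by rewrite /pturn xA.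
by rewrite /pturn label_unturn xA unturnK.
Qed.

Definition pdual_arc (x : endpoint E) : endpoint E :=
  punturn (vertex_arc G (pturn x)).

Lemma pdual_arcK : involutive pdual_arc.
Proof. by move=> x; rewrite /pdual_arc punturnK arcK pturnK. Qed.

Lemma pdual_arc_neq x : pdual_arc x != x.
Proof.
apply: contraNneq (arc_neq G (pturn x)) => {2}<-.
by rewrite /pdual_arc punturnK.
Qed.

Definition partial_dual : ribbon_graph E :=
  RibbonGraph pdual_arcK pdual_arc_neq (isolated G).

End Duals.

Section Deletion.
Variables (E : finType) (G : ribbon_graph E) (A : {set E}).

(* Once the arrows with label in A are erased, the arc leaving a remaining    *)
(* endpoint x runs over all erased arrows that it meets, up to the first      *)
(* remaining endpoint: if y is erased, go on along its arrow and the next     *)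
(* arc.  The number of endpoints bounds the number of steps needed.           *)
Definition skip (y : endpoint E) : endpoint E :=
  if label y \in A then vertex_arc G (along y) else y.
Definition walk (x : endpoint E) : endpoint E :=
  iter #|{: endpoint E}| skip (vertex_arc G x).

Let p (y : endpoint E) := vertex_arc G (along y).

Let p_inj : injective p.
Proof.
move=> x y /(can_inj (arcK G)) /(can_inj (@alongK E)); exact.
Qed.

Let skip_out n y : label y \notin A -> iter n skip y = y.
Proof.
by move=> /negbTE yA; elim: n => //= n ->; rewrite /skip yA.
Qed.

Let walk_spec x : label x \notin A ->
  exists k, [/\ walk x = iter k p (vertex_arc G x),
                label (walk x) \notin A &
                forall j, j < k -> label (iter j p (vertex_arc G x)) \in A].
Proof.
move=> xA; set z := vertex_arc G x.
have [k kN kA] : exists2 k, k < #|{: endpoint E}| &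
    label (iter k p z) \notin A.
  exists (fingraph.order p z).-1.
    by rewrite prednK ?fingraph.order_gt0 // max_card.
  rewrite -/(finv p z).
  have -> : finv p z = along x.
    by apply: p_inj; rewrite (f_finv p_inj) /p alongK.
  by [].
have exk : exists k, label (iter k p z) \notin A by exists k.
have [m mA minm] := ex_minnP exk.
have ltA j : j < m -> label (iter j p z) \in A.
  by move=> jm; apply: contraLR jm => jA; rewrite -leqNgt minm.
have it j : j <= m -> iter j skip z = iter j p z.
  elim: j => //= j IH jm; rewrite IH ?(ltnW jm) //.
  by rewrite /skip ltA.
have wE : walk x = iter m p z.
  have mN : m <= #|{: endpoint E}| by rewrite (leq_trans (minm _ kA)) // ltnW.
  by rewrite /walk -(subnK mN) iterD it // skip_out.
by exists m; split; rewrite ?wE.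
Qed.

Lemma label_walk x : label x \notin A -> label (walk x) \notin A.
Proof. by case/walk_spec=> k []. Qed.

Lemma walkK x : label x \notin A -> walk (walk x) = x.
Proof.
move=> xA; have [k [wE wA kA]] := walk_spec xA.
have [l [wwE wwA lA]] := walk_spec wA.
have rev j : j <= k ->
    iter j p (vertex_arc G (walk x)) =
      vertex_arc G (iter (k - j) p (vertex_arc G x)).
  elim: j => [_|j IH jk]; first by rewrite subn0 wE.
  by rewrite iterS IH 1?ltnW // -(subnSK jk) iterS {1}/p {1}/p arcK alongK.
have kx : iter k p (vertex_arc G (walk x)) = x by rewrite rev // subnn /= arcK.
rewrite wwE; case: (ltngtP l k) => [lk|kl|->] //.
  have := wwA; rewrite wwE (rev _ (ltnW lk)) -(subnSK lk) iterS {1}/p arcK.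
  by rewrite (kA (k - l.+1)) // ltn_subrL (leq_trans _ lk).
by have := lA _ kl; rewrite kx (negbTE xA).
Qed.

Let iterp_neq k x : iter k p (vertex_arc G x) != x.
Proof.
suff: (forall x, iter k p (vertex_arc G x) != x) /\
      (forall x, iter k.+1 p (vertex_arc G x) != x) by case.
elim: k => [|k [IH0 IH1]]; split=> // y; first exact: arc_neq.
  rewrite /= /p; apply/eqP=> /(congr1 (vertex_arc G)); rewrite arcK /along.
  by case: (vertex_arc G y) => a [].
pose u := along (vertex_arc G y).
have pu : p u = y by rewrite /p /u alongK arcK.
apply: contraNneq (IH0 u) => eqy; apply/eqP/p_inj.
by rewrite pu -[RHS]eqy iterS iterSr.
Qed.

Lemma walk_neq x : label x \notin A -> walk x != x.
Proof. by case/walk_spec=> k [-> _ _]; apply: iterp_neq. Qed.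

Definition remaining : finType := {e : E | e \notin A}.

Definition del_in (x : endpoint remaining) : endpoint E :=
  ((val x.1.1, x.1.2), x.2).

Lemma label_del_in x : label (del_in x) \notin A.
Proof. exact: (valP x.1.1). Qed.

Definition del_arc (x : endpoint remaining) : endpoint remaining :=
  let y := walk (del_in x) in
  ((exist _ (label y) (label_walk (label_del_in x)), y.1.2), y.2).

Lemma del_in_inj : injective del_in.
Proof. by move=> [[e i] b] [[e' i'] b'] [/val_inj-> -> ->]. Qed.

Lemma del_in_arc x : del_in (del_arc x) = walk (del_in x).
Proof. by rewrite /del_in /del_arc /label /=; case: (walk _) => [[]]. Qed.

Lemma del_arcK : involutive del_arc.
Proof.
by move=> x; apply: del_in_inj; rewrite !del_in_arc walkK ?label_del_in.
Qed.

Lemma del_arc_neq x : del_arc x != x.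
Proof.
apply: contraNneq (walk_neq (label_del_in x)) => xx.
by rewrite -del_in_arc xx.
Qed.

Definition delete : ribbon_graph remaining :=
  RibbonGraph del_arcK del_arc_neq
    (isolated G + #|[set B in circles (vertex_arc G) (@along E) |
                     [forall x in B, label x \in A]]|).

End Deletion.

(* Main.v *)
Require Import Defs.
From mathcomp Require Import all_boot.

Set Implicit Arguments.
Unset Strict Implicit.
Unset Printing Implicit Defensive.

(** A checkerboard colouring amounts to a two-colouring of the corners of the
    edge discs that is constant on vertex arcs and on edge line segments and
    changes along every arrow.  Partial duality with respect to A exchanges
    arrows and edge line segments for the edges in A only.  Hence a
    checkerboard colouring of G^A is a colouring of the corners of G, constant
    on vertex arcs, which changes along the arrows outside A and along the edge
    line segments in A, and is constant on the remaining segments.  Such a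
    colouring survives the erasure of the arrows in A, and, turned by duality,
    that of the arrows outside A in G^*.  Finally, in a checkerboard colourable
    graph every arrow has exactly one endpoint of each colour, so the degree of
    a vertex counts the points of one colour on its circle, and these are
    paired up by the arcs. *)

Lemma even_card_involution (T : finType) (f : T -> T) (S : {set T}) :
  involutive f -> (forall x, f x != x) -> {in S, forall x, f x \in S} ->
  ~~ odd #|S|.
Proof.
(* [L] keeps the lower-ranked point of each pair [x], [f x], so [f] carries [S :&: L] onto the rest
   of [S]. *)
move=> fK fN fS; pose L := [set x | enum_rank x < enum_rank (f x)].
suff -> : #|S| = #|S :&: L|.*2 by rewrite odd_double.
rewrite -(cardsID L S) -addnn; congr (_ + _).
rewrite -(card_imset (S :&: L) (can_inj fK)); apply/eq_card => x.
have swap : (x \notin L) = (f x \in L).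
  rewrite !inE fK -leqNgt leq_eqVlt; case: eqP => // /ord_inj/enum_rank_inj fx.
  by have := fN x; rewrite fx eqxx.
rewrite in_setD swap; apply/andP/imsetP => [[fxL xS]|[y]].
  by exists (f x); rewrite ?fK // inE fxL fS.
by rewrite inE => /andP[yS yL] ->; rewrite fK yL fS.
Qed.

Section Colourings.
Variables (E : finType) (G : ribbon_graph E).
Implicit Types (d : endpoint E -> bool) (x : endpoint E).

Lemma arc_mem_circle (g : endpoint E -> endpoint E) (B : {set endpoint E}) x :
  B \in circles (vertex_arc G) g -> x \in B -> vertex_arc G x \in B.
Proof.
case/imsetP=> y _ ->; rewrite !inE => yx; apply: connect_trans yx _.
by apply: connect1; rewrite /= eqxx.
Qed.

Lemma along_mem_circle (f : endpoint E -> endpoint E) (B : {set endpoint E}) x :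
  B \in circles f (@along E) -> x \in B -> along x \in B.
Proof.
case/imsetP=> y _ ->; rewrite !inE => yx; apply: connect_trans yx _.
by apply: connect1; rewrite /= eqxx orbT.
Qed.

Lemma checkerboardP :
  checkerboard G <->
  exists d, [/\ forall x, d (vertex_arc G x) = d x,
                forall x, d (line x) = d x &
                forall x, d (along x) = ~~ d x].
Proof.
pose r := [rel u v : endpoint E | (v == vertex_arc G u) || (v == line u)].
have lineK : involutive (@line E).
  by case=> [[e i] b]; rewrite /line /mate /= !negbK.
have r_sym : connect_sym r.
  apply: sym_connect_sym => u v /=.
  by rewrite -[v == _](inv_eq (arcK G)) -[v == line u](inv_eq lineK) ![_ == u]eq_sym.
split=> [[c cP]|[d [dA dL dF]]].
  have face_eq u v : r u v -> face_of G v = face_of G u.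
    move=> uv; congr inl; apply: val_inj; apply/setP => y; rewrite !inE.
    have /(same_connect r_sym) : connect r u v by apply: connect1.
    by move->.
  exists (fun x => c (face_of G x)).
  have dL x : c (face_of G (line x)) = c (face_of G x).
    by rewrite (face_eq x) //= eqxx orbT.
  split=> [x | // | x]; first by rewrite (face_eq x) //= eqxx.
  case: x => [[e i] b].
  (* The tail of an arrow shares an edge line segment with the head of its mate, so changing along
     an arrow means changing between the two sides of [e]. *)
  have := dL ((e, false), true); have := dL ((e, true), true).
  have := cP e; rewrite /line /along /mate /arrow_head /=.
  case: i b => -[] /=; do 4! case: (c _) => //=.
(* Since [d] is constant on a face circle, any one point decides its colour. Isolated discs border
   no edge, so their colour is arbitrary. *)
exists (fun F : face G =>
  if F is inl B then [exists x in val B, d x] else false).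
have col x : [exists y in circle (vertex_arc G) (@line E) x, d y] = d x.
  have inv u v : connect r u v -> d v = d u.
    move/connectP=> [p + ->]; elim: p u => //= w p IH u /andP[uw /IH ->].
    by case/orP: uw => /eqP ->.
  apply/exists_inP/idP => [[y]|dx]; last by exists x; rewrite // inE connect0.
  by rewrite inE => /inv ->.
move=> e; rewrite /= !col -(dL (arrow_head (e, false))).
by rewrite -[line _]/(along (arrow_head (e, true))) dF; case: (d _).
Qed.

Lemma checkerboard_eulerian : checkerboard G -> eulerian G.
Proof.
case/checkerboardP=> d [dA _ dF] [[B Bc]|] //=.
pose S := [set x in B | d x].
have S_even : ~~ odd #|S|.
  apply: (even_card_involution (@arcK _ G) (@arc_neq _ G)) => x.
  by rewrite !inE dA => /andP[xB ->]; rewrite (arc_mem_circle Bc).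
have inB a b : ((a, b) \in B) = (arrow_head a \in B).
  case: b => //; apply/idP/idP; apply: (along_mem_circle Bc).
suff -> : [set a | arrow_head a \in B] = [set x.1 | x in S].
  rewrite card_in_imset // => -[a b] [a' b']; rewrite !inE /=.
  move=> /andP[_ dx] /andP[_ dx'] eqa; move: dx dx'; rewrite -{}eqa.
  have := dF (a, true); rewrite /along /=.
  by case: b b' => -[] //= ->; case: (d _).
apply/setP=> a; rewrite inE; apply/idP/imsetP => [aB|[[a' b] + ->]].
  (* Used as an end selector, [d (a, true)] picks the endpoint of [a] whose colour is [true]. *)
  exists (a, d (a, true)) => //; rewrite inE inB aB /=.
  by case E1: (d (a, true)) => //; have := dF (a, true); rewrite E1.
by rewrite inE inB => /andP[].
Qed.

End Colourings.

(** A [walk] follows only vertex arcs and erased arrows, and [d] is constant along both, whatever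
    the number of steps. *)
Lemma checkerboard_delete (E : finType) (G : ribbon_graph E) (A : {set E})
    (d : endpoint E -> bool) :
  (forall x, d (vertex_arc G x) = d x) ->
  (forall x, d (along x) = (label x \notin A) (+) d x) ->
  (forall x, label x \notin A -> d (line x) = d x) ->
  checkerboard (delete G A).
Proof.
move=> dA dF dL; apply/checkerboardP; exists (fun x => d (del_in x)).
have dW x : d (walk G A x) = d x.
  rewrite /walk -[RHS]dA; elim: #|_| => //= n <-.
  rewrite {1}/skip; case: ifP => // yA.
  by rewrite dA dF yA.
split=> x; first by rewrite /= del_in_arc dW.
  by rewrite -(dL _ (label_del_in x)).
by rewrite -[~~ _]/(true (+) _) -(label_del_in x) -dF.
Qed.

Lemma checkerboard_partial_dual (E : finType) (G : ribbon_graph E)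
    (A : {set E}) :
  checkerboard (partial_dual G A) ->
  exists d : endpoint E -> bool,
    [/\ forall x, d (vertex_arc G x) = d x,
        forall x, d (along x) = (label x \notin A) (+) d x &
        forall x, d (line x) = (label x \in A) (+) d x].
Proof.
(* For labels in [A], [unturn] turns [along] into [line] and [line] into [along]; other labels are
   left alone. *)
case/checkerboardP=> d [dA dL dF]; exists (fun x => d (punturn A x)).
split=> [x | [[e i] b] | [[e i] b]].
- by rewrite -[RHS]dA /= /pdual_arc punturnK.
- rewrite /punturn /label /=; case: (e \in A) => /=; last exact: dF.
  by case: b; rewrite /unturn /= -dL /line /mate /= ?negbK.
rewrite /punturn /label /=; case: (e \in A) => /=; last exact: dL.
by case: b; rewrite /unturn /mate /= -dF /along /= ?negbK // -dL /line /mate /= negbK.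
Qed.

Theorem theorem4 (E : finType) (G : ribbon_graph E) (A : {set E}) :
  checkerboard (partial_dual G A) ->
  (checkerboard (delete G A) /\ checkerboard (delete (geom_dual G) (~: A))) /\
  (eulerian (delete G A) /\ eulerian (delete (geom_dual G) (~: A))).
Proof.
case/checkerboard_partial_dual=> d [dA dF dL].
have cG : checkerboard (delete G A).
  by apply: (checkerboard_delete dA dF) => x xA; rewrite dL (negbTE xA).
have cG' : checkerboard (delete (geom_dual G) (~: A)).
  have turn_along x : turn (along x) = line (turn x).
    by case: x => [[e i] []]; rewrite /turn /line /mate /= ?negbK.
  have turn_line x : turn (line x) = along (turn x).
    by case: x => [[e i] []]; rewrite /turn /along /mate /= ?negbK.
  (* Reading [d] through [turn] swaps its conditions on arrows and on edge line segments, which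
     matches replacing [A] by [~: A]. *)
  apply: (@checkerboard_delete _ _ _ (fun x => d (turn x))) => x.
  - by rewrite /= /dual_arc unturnK dA.
  - by rewrite turn_along dL label_turn inE negbK.
  by rewrite turn_line dF label_turn inE negbK => ->.
by split; split=> //; apply: checkerboard_eulerian.
Qed.
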